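(* Let $n\ge 1$, let $\Sigma_n$ be the symmetric group on $\{1,\dots,n\}$, and let $G$ be any subgroup of $\Sigma_n$. Let $X^n=\{(x_1,\ldots,x_n)\in(\mathbb{R}^3)^n : i\neq j\implies x_i\neq x_j\}$, and let $X^n/G$ be the quotient of $X^n$ by the action of $G$ permuting coordinates. Then $\pi_1(X^n/G)\cong G$.
   Context: $\mathbb{R}^3$ has its usual topology and $X^n\subset(\mathbb{R}^3)^n\cong\mathbb{R}^{3n}$ has the subspace topology (Euclidean metric). The group $G\le\Sigma_n$ acts on $X^n$ by permuting components: $\sigma*(x_1,\ldots,x_n)=(x_{\sigma(1)},\ldots,x_{\sigma(n)})$ for $\sigma\in G$. The space $X^n/G$ is the set of orbits of this action, with the quotient topology. *)

(* Defs.v *)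
From HB Require Import structures.
From mathcomp Require Import all_boot all_order all_algebra all_fingroup.
From mathcomp Require Import generic_quotient.
From mathcomp Require Import all_classical all_reals.
From mathcomp Require Import topology normedtype homotopy.
From mathcomp Require Import ring lra.

Set Implicit Arguments.
Unset Strict Implicit.
Unset Printing Implicit Defensive.

Import Order.TTheory GRing.Theory Num.Theory.
Import numFieldNormedType.Exports.

Local Open Scope classical_set_scope.
Local Open Scope ring_scope.
Local Open Scope quotient_scope.

(** * The unit interval *)

Definition unit_interval (R : realType) : Type := set_type `[0 : R, 1]%classic.

HB.instance Definition _ (R : realType) :=
  Topological.copy (unit_interval R) (set_type `[0 : R, 1]%classic).

Definition ival (R : realType) (t : unit_interval R) : R := set_val t.

Lemma clamp_subproof (R : realType) (t : R) :
  Num.max 0 (Num.min 1 t) \in `[0 : R, 1]%classic.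
Proof.
rewrite inE /= in_itv /=; apply/andP; split; first by rewrite le_max lexx.
by rewrite ge_max ler01 /= ge_min lexx.
Qed.

Definition clamp (R : realType) (t : R) : unit_interval R :=
  @exist R (fun x => x \in `[0 : R, 1]%classic) _ (clamp_subproof t).

Section UnitInterval.
Context {R : realType}.
Implicit Types (t : unit_interval R) (r : R).

Lemma ival_itv t : 0 <= ival t <= 1.
Proof. by case: t => t tP; move: (set_mem tP); rewrite /= in_itv. Qed.

Lemma ival_inj : injective (@ival R).
Proof. by move=> s t; exact: val_inj. Qed.

Lemma clampE r : ival (clamp r) = Num.max 0 (Num.min 1 r).
Proof. by []. Qed.

Lemma clampK r : 0 <= r <= 1 -> ival (clamp r) = r.
Proof. by case/andP=> r0 r1; rewrite clampE min_r// max_r. Qed.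

Lemma ivalK t : clamp (ival t) = t.
Proof. by apply: ival_inj; rewrite clampK// ival_itv. Qed.

Lemma clamp_le0 r : r <= 0 -> clamp r = clamp 0.
Proof.
move=> r0; apply: ival_inj; rewrite [RHS]clampK ?lexx ?ler01// clampE.
by rewrite min_r ?max_l// (le_trans r0).
Qed.

Lemma clamp_ge1 r : 1 <= r -> clamp r = clamp 1.
Proof.
move=> r1; apply: ival_inj; rewrite [RHS]clampK ?lexx ?ler01// clampE.
by rewrite min_l ?max_r.
Qed.

Lemma ival_continuous : continuous (@ival R).
Proof. exact: initial_continuous. Qed.

Lemma clamp_continuous : continuous (@clamp R).
Proof.
apply/continuousP => A [B oB <-].
rewrite -comp_preimage; apply: open_comp => // r _.
apply: continuous_max; first exact: cst_continuous.
by apply: continuous_min; [exact: cst_continuous | move=> ?].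
Qed.

Lemma unit_interval_neq : clamp 0 != clamp 1 :> unit_interval R.
Proof.
apply/eqP => /(congr1 (@ival R)); rewrite !clampK ?lexx ?ler01//.
by move/eqP; rewrite eq_sym oner_eq0.
Qed.

HB.instance Definition _ :=
  isBiPointed.Build (unit_interval R) unit_interval_neq.

Lemma ival0 : ival (zero : unit_interval R) = 0.
Proof. by rewrite clampK// lexx ler01. Qed.

Lemma ival1 : ival (one : unit_interval R) = 1.
Proof. by rewrite clampK// lexx ler01. Qed.

End UnitInterval.

(** * Homotopy of paths relative to the endpoints *)

Lemma comp_continuous (S U V : topologicalType) (g : U -> V) (f : S -> U) :
  continuous g -> continuous f -> continuous (fun s => g (f s)).
Proof. by move=> cg cf s; apply: continuous_comp; [exact: cf | exact: cg]. Qed.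

Lemma pair_continuous (S U V : topologicalType) (f : S -> U) (g : S -> V) :
  continuous f -> continuous g -> continuous (fun s => (f s, g s)).
Proof. by move=> cf cg s; apply: cvg_pair; [exact: cf | exact: cg]. Qed.

Section RealContinuous.
Context {R : realType} {S : topologicalType}.
Implicit Types (h k : S -> R) (a : R).

Lemma addf_continuous h k :
  continuous h -> continuous k -> continuous (fun s => h s + k s).
Proof. by move=> ch ck s; apply: cvgD; [exact: ch | exact: ck]. Qed.

Lemma mulf_continuous h k :
  continuous h -> continuous k -> continuous (fun s => h s * k s).
Proof. by move=> ch ck s; apply: cvgM; [exact: ch | exact: ck]. Qed.

Lemma mulc_continuous a h : continuous h -> continuous (fun s => a * h s).
Proof. by apply: mulf_continuous => s; exact: cvg_cst. Qed.

Lemma subc_continuous a h : continuous h -> continuous (fun s => h s - a).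
Proof. by move=> ch; apply: addf_continuous => // s; exact: cvg_cst. Qed.

Lemma csub_continuous a h : continuous h -> continuous (fun s => a - h s).
Proof. by move=> ch s; apply: cvgB; [exact: cvg_cst | exact: ch]. Qed.

Lemma minf_continuous h k :
  continuous h -> continuous k -> continuous (fun s => Num.min (h s) (k s)).
Proof. by move=> ch ck s; apply: continuous_min; [exact: ch | exact: ck]. Qed.

Lemma maxf_continuous h k :
  continuous h -> continuous k -> continuous (fun s => Num.max (h s) (k s)).
Proof. by move=> ch ck s; apply: continuous_max; [exact: ch | exact: ck]. Qed.

Lemma addc_continuous a h : continuous h -> continuous (fun s => h s + a).
Proof. by move=> ch; apply: addf_continuous => // s; exact: cvg_cst. Qed.

End RealContinuous.

Section Homotopy.
Context {R : realType} {T : topologicalType}.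
Local Notation I := (unit_interval R).

Lemma paste_continuous (S : topologicalType) (h : S -> R) (c : R)
    (f g : S -> T) :
  continuous h -> continuous f -> continuous g ->
  (forall s, h s = c -> f s = g s) ->
  continuous (fun s => if h s <= c then f s else g s).
Proof.
move=> ch cf cg fg s U; rewrite /=.
have [hs|hs|hs] := ltgtP (h s) c => nU; last first.
- have fU : nbhs s (f @^-1` U) := cf s U nU.
  have gU : nbhs s (g @^-1` U) by apply: cg; rewrite -fg.
  apply: filterS2 fU gU => z /= fz gz; by case: ifP.
- have hlt : nbhs s (h @^-1` [set r | c < r]).
    by apply: ch; apply: open_nbhs_nbhs; split; [exact: open_gt | exact: hs].
  have gU : nbhs s (g @^-1` U) := cg s U nU.
  apply: filterS2 hlt gU => z /= hz gz; by rewrite leNgt hz.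
- have hlt : nbhs s (h @^-1` [set r | r < c]).
    by apply: ch; apply: open_nbhs_nbhs; split; [exact: open_lt | exact: hs].
  have fU : nbhs s (f @^-1` U) := cf s U nU.
  apply: filterS2 hlt fU => z /= hz fz; by rewrite ltW.
Qed.

Lemma halfK : 2 * 2^-1 = 1 :> R. Proof. lra. Qed.

Definition homotopic (x y : T) (p q : {path I from x to y}) : Prop :=
  exists H : I * I -> T,
    [/\ continuous H,
        forall t, H (t, zero) = p t,
        forall t, H (t, one) = q t,
        forall s, H (zero, s) = x &
        forall s, H (one, s) = y].

Section Concat.
Context {x y z : T} (p : {path I from x to y}) (q : {path I from y to z}).

Definition concat (t : I) : T :=
  if ival t <= 2^-1 then p (clamp (2 * ival t))
  else q (clamp (2 * ival t - 1)).

Lemma concat_continuous : continuous concat.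
Proof.
apply: paste_continuous; first exact: ival_continuous.
- apply: (comp_continuous (g := p)); first exact: cts_fun.
  apply: comp_continuous; first exact: clamp_continuous.
  by apply: mulc_continuous; exact: ival_continuous.
- apply: (comp_continuous (g := q)); first exact: cts_fun.
  apply: comp_continuous; first exact: clamp_continuous.
  by apply: subc_continuous; apply: mulc_continuous; exact: ival_continuous.
- by move=> t ->; rewrite halfK subrr path_one path_zero.
Qed.

Lemma concat_zero : concat zero = x.
Proof. by rewrite /concat ival0 invr_ge0 ler0n mulr0 path_zero. Qed.

Lemma concat_one : concat one = z.
Proof.
rewrite /concat ival1 ifF; last by apply/negP; lra.
by rewrite (_ : 2 * 1 - 1 = 1) ?path_one//; lra.
Qed.

HB.instance Definition _ := isContinuous.Build I T concat concat_continuous.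
HB.instance Definition _ := isPath.Build I T x z concat concat_zero concat_one.

Definition reverse (t : I) : T := p (clamp (1 - ival t)).

Lemma reverse_continuous : continuous reverse.
Proof.
apply: (comp_continuous (g := p)); first exact: cts_fun.
apply: comp_continuous; first exact: clamp_continuous.
by apply: csub_continuous; exact: ival_continuous.
Qed.

Lemma reverse_zero : reverse zero = y.
Proof. by rewrite /reverse ival0 subr0 path_one. Qed.

Lemma reverse_one : reverse one = x.
Proof. by rewrite /reverse ival1 subrr path_zero. Qed.

HB.instance Definition _ := isContinuous.Build I T reverse reverse_continuous.
HB.instance Definition _ :=
  isPath.Build I T y x reverse reverse_zero reverse_one.

End Concat.

Lemma concatE (x y z : T) (p : {path I from x to y}) (q : {path I from y to z})
    (t : I) :
  concat p q t = if ival t <= 2^-1 then p (clamp (2 * ival t))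
                 else q (clamp (2 * ival t - 1)).
Proof. by []. Qed.

Lemma homotopic_refl (x y : T) (p : {path I from x to y}) : homotopic p p.
Proof.
exists (fun ts => p ts.1); split => //.
- by apply: (comp_continuous (g := p)); [exact: cts_fun | move=> ts; exact: cvg_fst].
- by move=> s /=; exact: path_zero.
- by move=> s /=; exact: path_one.
Qed.

Lemma homotopic_sym (x y : T) (p q : {path I from x to y}) :
  homotopic p q -> homotopic q p.
Proof.
case=> H [cH H0 H1 Hx Hy].
exists (fun ts => H (ts.1, clamp (1 - ival ts.2))); split => //= [|t|t].
- apply: (comp_continuous (g := H)) => //.
  apply: pair_continuous; first by move=> ts; exact: cvg_fst.
  apply: comp_continuous; first exact: clamp_continuous.
  apply: csub_continuous.
  by apply: (comp_continuous (@ival_continuous R) (f := snd)) => ?; exact: cvg_snd.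
- by rewrite ival0 subr0; exact: H1.
- by rewrite ival1 subrr; exact: H0.
Qed.

Lemma homotopic_trans (x y : T) (p q r : {path I from x to y}) :
  homotopic p q -> homotopic q r -> homotopic p r.
Proof.
move=> [H [cH H0 H1 Hx Hy]] [K [cK K0 K1 Kx Ky]].
exists (fun ts => if ival ts.2 <= 2^-1 then H (ts.1, clamp (2 * ival ts.2))
                  else K (ts.1, clamp (2 * ival ts.2 - 1))).
have c2 : continuous (fun ts : I * I => ival ts.2).
  by apply: comp_continuous; [exact: ival_continuous | move=> ts; exact: cvg_snd].
split => /=.
- apply: paste_continuous => //.
  + apply: (comp_continuous (g := H)) => //.
    apply: pair_continuous; first by move=> ts; exact: cvg_fst.
    apply: comp_continuous; first exact: clamp_continuous.
    by apply: mulc_continuous; exact: c2.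
  + apply: (comp_continuous (g := K)) => //.
    apply: pair_continuous; first by move=> ts; exact: cvg_fst.
    apply: comp_continuous; first exact: clamp_continuous.
    by apply: subc_continuous; apply: mulc_continuous; exact: c2.
  + by move=> ts ->; rewrite halfK subrr H1 K0.
- by move=> t; rewrite ival0 invr_ge0 ler0n mulr0 H0.
- move=> t; rewrite ival1 ifF; last by apply/negP; lra.
  by rewrite (_ : 2 * 1 - 1 = 1) ?K1//; lra.
- by move=> s; rewrite Hx Kx; case: ifP.
- by move=> s; rewrite Hy Ky; case: ifP.
Qed.

Lemma homotopic_concat (x y z : T) (p p' : {path I from x to y})
    (q q' : {path I from y to z}) :
  homotopic p p' -> homotopic q q' -> homotopic (concat p q) (concat p' q').
Proof.
move=> [H [cH H0 H1 Hx Hy]] [K [cK K0 K1 Kx Ky]].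
exists (fun ts => if ival ts.1 <= 2^-1 then H (clamp (2 * ival ts.1), ts.2)
                  else K (clamp (2 * ival ts.1 - 1), ts.2)).
have c1 : continuous (fun ts : I * I => ival ts.1).
  by apply: comp_continuous; [exact: ival_continuous | move=> ts; exact: cvg_fst].
split => /=.
- apply: paste_continuous => //.
  + apply: (comp_continuous (g := H)) => //.
    apply: pair_continuous; last by move=> ts; exact: cvg_snd.
    apply: comp_continuous; first exact: clamp_continuous.
    by apply: mulc_continuous; exact: c1.
  + apply: (comp_continuous (g := K)) => //.
    apply: pair_continuous; last by move=> ts; exact: cvg_snd.
    apply: comp_continuous; first exact: clamp_continuous.
    by apply: subc_continuous; apply: mulc_continuous; exact: c1.
  + by move=> ts ->; rewrite halfK subrr Hy Kx.
- by move=> t; rewrite /concat H0 K0.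
- by move=> t; rewrite /concat H1 K1.
- by move=> s; rewrite ival0 invr_ge0 ler0n mulr0 Hx.
- move=> s; rewrite ival1 ifF; last by apply/negP; lra.
  by rewrite (_ : 2 * 1 - 1 = 1) ?Ky//; lra.
Qed.

Lemma homotopic_reverse (x y : T) (p p' : {path I from x to y}) :
  homotopic p p' -> homotopic (reverse p) (reverse p').
Proof.
move=> [H [cH H0 H1 Hx Hy]].
exists (fun ts => H (clamp (1 - ival ts.1), ts.2)); split => //= [|t|t|s|s].
- apply: (comp_continuous (g := H)) => //.
  apply: pair_continuous; last by move=> ts; exact: cvg_snd.
  apply: comp_continuous; first exact: clamp_continuous.
  apply: csub_continuous.
  by apply: (comp_continuous (@ival_continuous R) (f := fst)) => ?; exact: cvg_fst.
- exact: H0.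
- exact: H1.
- by rewrite ival0 subr0 Hy.
- by rewrite ival1 subrr Hx.
Qed.

(* Two paths factoring through a common path by maps [0, 1] -> R that agree
   at the endpoints are homotopic, by the straight-line homotopy. *)
Lemma homotopic_reparam (a b x y : T) (c : {path I from a to b})
    (p q : {path I from x to y}) (phi psi : R -> R) :
  continuous phi -> continuous psi ->
  phi 0 = psi 0 -> phi 1 = psi 1 ->
  (forall t, p t = c (clamp (phi (ival t)))) ->
  (forall t, q t = c (clamp (psi (ival t)))) ->
  homotopic p q.
Proof.
move=> cphi cpsi e0 e1 pE qE.
pose g (ts : I * I) := (1 - ival ts.2) * phi (ival ts.1)
                       + ival ts.2 * psi (ival ts.1).
exists (c \o @clamp R \o g).
have c1 : continuous (fun ts : I * I => ival ts.1).
  by apply: comp_continuous; [exact: ival_continuous | move=> ts; exact: cvg_fst].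
have c2 : continuous (fun ts : I * I => ival ts.2).
  by apply: comp_continuous; [exact: ival_continuous | move=> ts; exact: cvg_snd].
have cg : continuous g.
  apply: addf_continuous; apply: mulf_continuous => //.
  - exact: csub_continuous.
  - exact: (comp_continuous cphi c1).
  - exact: (comp_continuous cpsi c1).
have gz s : g (zero, s) = phi 0 by rewrite /g /= ival0 -e0; ring.
have go s : g (one, s) = phi 1 by rewrite /g /= ival1 -e1; ring.
split => /=.
- apply: (comp_continuous (g := c)); first exact: cts_fun.
  exact: (comp_continuous (@clamp_continuous R)).
- by move=> t; rewrite pE /g /= ival0 subr0 mul1r mul0r addr0.
- by move=> t; rewrite qE /g /= ival1 subrr mul1r mul0r add0r.
- by move=> s; rewrite gz -(path_zero (s := p)) pE ival0.
- by move=> s; rewrite go -(path_one (s := p)) pE ival1.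
Qed.

Lemma homotopic_concatA (x y z w : T) (p : {path I from x to y})
    (q : {path I from y to z}) (r : {path I from z to w}) :
  homotopic (concat p (concat q r)) (concat (concat p q) r).
Proof.
pose psi (t : R) := Num.min (2 * t) (Num.min (t + 4^-1) (2^-1 * t + 2^-1)).
have psi1 t : t <= 4^-1 -> psi t = 2 * t.
  by move=> h; rewrite /psi min_l// le_min; apply/andP; split; lra.
have psi2 t : 4^-1 <= t -> t <= 2^-1 -> psi t = t + 4^-1.
  by move=> h k; rewrite /psi (min_l (y := _ * _ + _)) ?min_r//; lra.
have psi3 t : 2^-1 <= t -> t <= 1 -> psi t = 2^-1 * t + 2^-1.
  by move=> h k; rewrite /psi (min_r (y := _ * _ + _)) ?min_r//; lra.
apply: (@homotopic_reparam _ _ _ _ (concat p (concat q r)) _ _ idfun psi).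
- by move=> t; exact: cvg_id.
- apply: minf_continuous; first by apply: mulc_continuous => t; exact: cvg_id.
  apply: minf_continuous; apply: addc_continuous; last apply: mulc_continuous.
  + by move=> t; exact: cvg_id.
  + by move=> t; exact: cvg_id.
- by rewrite psi1 /=; lra.
- by rewrite psi3 /=; lra.
- by move=> t; rewrite ivalK.
move=> t; have := ival_itv t; rewrite /= !concatE /= ?concatE.
set s := ival t => /andP[s0 s1].
have [h1|h1] := leP s (2^-1).
  rewrite (@clampK _ (2 * s)); last by apply/andP; split; lra.
  have [h2|h2] := leP (2 * s) (2^-1).
    rewrite psi1; last lra.
    by rewrite clampK ?h2//; apply/andP; split; lra.
  rewrite psi2; [|lra..].
  rewrite (@clampK _ (s + 4^-1)); last by apply/andP; split; lra.
  rewrite ifF; last by apply/negP; lra.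
  rewrite clampK; last by apply/andP; split; lra.
  rewrite ifT; last lra.
  by congr (q (clamp _)); lra.
rewrite psi3; [|lra..].
rewrite (@clampK _ (2^-1 * s + 2^-1)); last by apply/andP; split; lra.
rewrite ifF; last by apply/negP; lra.
rewrite clampK; last by apply/andP; split; lra.
rewrite ifF; last by apply/negP; lra.
by congr (r (clamp _)); lra.
Qed.

Lemma homotopic_concat1p (x y : T) (p : {path I from x to y}) :
  homotopic (concat (cst x : {path I from x to x}) p) p.
Proof.
apply: (@homotopic_reparam _ _ _ _ p _ _ (fun t => Num.max 0 (2 * t - 1)) idfun) => //.
- apply: maxf_continuous; first by move=> t; exact: cvg_cst.
  apply: subc_continuous.
  by apply: mulc_continuous => t; exact: cvg_id.
- by move=> t; exact: cvg_id.
- by rewrite maxElt /=; case: ltP => /=; lra.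
- by rewrite maxElt /=; case: ltP => /=; lra.
- move=> t; rewrite /= concatE /=; case: leP => h; rewrite maxElt; case: ltP => //= h'.
  + by exfalso; lra.
  + by rewrite path_zero.
  + by exfalso; lra.
- by move=> t; rewrite ivalK.
Qed.

Lemma homotopic_concatp1 (x y : T) (p : {path I from x to y}) :
  homotopic (concat p (cst y : {path I from y to y})) p.
Proof.
apply: (@homotopic_reparam _ _ _ _ p _ _ (fun t => Num.min (2 * t) 1) idfun) => //.
- apply: minf_continuous; last by move=> t; exact: cvg_cst.
  by apply: mulc_continuous => t; exact: cvg_id.
- by move=> t; exact: cvg_id.
- by rewrite minElt /=; case: ltP => /=; lra.
- by rewrite minElt /=; case: ltP => /=; lra.
- move=> t; rewrite /= concatE /=; case: leP => h; rewrite minElt; case: ltP => //= h'.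
  + by rewrite clamp_ge1.
  + by exfalso; lra.
  + by rewrite path_one.
- by move=> t; rewrite ivalK.
Qed.

Lemma homotopic_concatpV (x y : T) (p : {path I from x to y}) :
  homotopic (concat p (reverse p)) (cst x).
Proof.
apply: (@homotopic_reparam _ _ _ _ p _ _
  (fun t => Num.min (2 * t) (2 - 2 * t)) (fun=> 0)) => //.
- apply: minf_continuous.
    by apply: mulc_continuous => t; exact: cvg_id.
  apply: csub_continuous.
  by apply: mulc_continuous => t; exact: cvg_id.
- by move=> t; exact: cvg_cst.
- by rewrite minElt /=; case: ltP => /=; lra.
- by rewrite minElt /=; case: ltP => /=; lra.
- move=> t; have /andP[t0 t1] := ival_itv t; rewrite /= concatE /= /reverse.
  case: leP => h; rewrite minElt; case: ltP => h' //=; try by exfalso; lra.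
  + by congr (p (clamp _)); lra.
  + rewrite clampK; last by apply/andP; split; lra.
    by congr (p (clamp _)); lra.
- by move=> t; rewrite path_zero.
Qed.

Lemma homotopic_concatVp (x y : T) (p : {path I from x to y}) :
  homotopic (concat (reverse p) p) (cst y).
Proof.
apply: (@homotopic_reparam _ _ _ _ p _ _
  (fun t => Num.max (1 - 2 * t) (2 * t - 1)) (fun=> 1)) => //.
- apply: maxf_continuous.
    apply: csub_continuous.
    by apply: mulc_continuous => t; exact: cvg_id.
  apply: subc_continuous.
  by apply: mulc_continuous => t; exact: cvg_id.
- by move=> t; exact: cvg_cst.
- by rewrite maxElt /=; case: ltP => /=; lra.
- by rewrite maxElt /=; case: ltP => /=; lra.
- move=> t; have /andP[t0 t1] := ival_itv t; rewrite /= concatE /= /reverse.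
  case: leP => h; rewrite maxElt; case: ltP => h' //=; try by exfalso; lra.
  + rewrite clampK; last by apply/andP; split; lra.
    by congr (p (clamp _)); lra.
- by move=> t; rewrite path_one.
Qed.

End Homotopy.

(** * The fundamental group *)

Section FundamentalGroup.
Context (R : realType) {T : topologicalType} (x : T).
Local Notation I := (unit_interval R).
Local Notation loop := {path I from x to x}.

Definition homotopicb (p q : loop) : bool := `[< homotopic p q >].

Lemma homotopicb_refl : reflexive homotopicb.
Proof. by move=> p; apply/asboolP; exact: homotopic_refl. Qed.

Lemma homotopicb_sym : symmetric homotopicb.
Proof. by move=> p q; apply/asboolP/asboolP; exact: homotopic_sym. Qed.

Lemma homotopicb_trans : transitive homotopicb.
Proof.
by move=> q p r /asboolP pq /asboolP qr; apply/asboolP; exact: homotopic_trans pq qr.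
Qed.

Canonical homotopicb_equiv :=
  EquivRel homotopicb homotopicb_refl homotopicb_sym homotopicb_trans.

Definition fundamental_group : Type := {eq_quot homotopicb_equiv}.
Local Notation pi1 := fundamental_group.

HB.instance Definition _ := Choice.on pi1.
HB.instance Definition _ := EqQuotient.on pi1.

Lemma pi1_eqP (p q : loop) : \pi_pi1 p = \pi_pi1 q <-> homotopic p q.
Proof.
split; first by move/eqmodP => /asboolP.
by move=> pq; apply/eqmodP/asboolP.
Qed.

Lemma pi1_reprK (p : loop) : homotopic (repr (\pi_pi1 p)) p.
Proof. by apply/pi1_eqP; rewrite reprK. Qed.

Definition pi1_mul (a b : pi1) : pi1 := \pi_pi1 (concat (repr a) (repr b)).
Definition pi1_one : pi1 := \pi_pi1 (cst x).
Definition pi1_inv (a : pi1) : pi1 := \pi_pi1 (reverse (repr a)).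

Lemma pi1_mulE (p q : loop) :
  pi1_mul (\pi_pi1 p) (\pi_pi1 q) = \pi_pi1 (concat p q).
Proof. by apply/pi1_eqP; apply: homotopic_concat; exact: pi1_reprK. Qed.

Lemma pi1_invE (p : loop) : pi1_inv (\pi_pi1 p) = \pi_pi1 (reverse p).
Proof. by apply/pi1_eqP; apply: homotopic_reverse; exact: pi1_reprK. Qed.

Lemma pi1_mulA : associative pi1_mul.
Proof.
elim/quotW=> p; elim/quotW=> q; elim/quotW=> r.
rewrite (pi1_mulE q r) (pi1_mulE p q) (pi1_mulE p) pi1_mulE.
by apply/pi1_eqP; exact: homotopic_concatA.
Qed.

Lemma pi1_mul1 : left_id pi1_one pi1_mul.
Proof.
by elim/quotW=> p; rewrite pi1_mulE; apply/pi1_eqP; exact: homotopic_concat1p.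
Qed.

Lemma pi1_mulr1 : right_id pi1_one pi1_mul.
Proof.
by elim/quotW=> p; rewrite pi1_mulE; apply/pi1_eqP; exact: homotopic_concatp1.
Qed.

Lemma pi1_mulV : left_inverse pi1_one pi1_inv pi1_mul.
Proof.
elim/quotW=> p; rewrite pi1_invE pi1_mulE; apply/pi1_eqP.
exact: homotopic_concatVp.
Qed.

Lemma pi1_mulrV : right_inverse pi1_one pi1_inv pi1_mul.
Proof.
elim/quotW=> p; rewrite pi1_invE pi1_mulE; apply/pi1_eqP.
exact: homotopic_concatpV.
Qed.

HB.instance Definition _ := isGroup.Build pi1
  pi1_mulA pi1_mul1 pi1_mulr1 pi1_mulV pi1_mulrV.

End FundamentalGroup.

(** * Configuration spaces and their quotients *)

(* The rows of [x : 'M[R]_(n, 3)] are the points [x_1, ..., x_n] of [R^3]. The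
   topology on matrices is the product topology of the entries, which is the
   topology of the Euclidean metric on [R^(3n)]. *)
Definition config_set (R : realType) (n : nat) : set 'M[R]_(n, 3) :=
  [set x | forall i j, i != j -> row i x != row j x].

Definition config (R : realType) (n : nat) : Type :=
  set_type (@config_set R n).

HB.instance Definition _ (R : realType) (n : nat) :=
  Topological.copy (config R n) (set_type (@config_set R n)).

Lemma config_set_nonempty (R : realType) (n : nat) : @config_set R n !=set0.
Proof.
exists (\matrix_(i, j) i%:R) => i j; apply: contra_neq => /rowP/(_ ord0).
by rewrite !mxE => /eqP; rewrite eqr_nat => /eqP /val_inj.
Qed.

Section ConfigQuotient.
Context (R : realType) {n : nat}.

Lemma config_perm_subproof (s : 'S_n) (x : config R n) :
  row_perm s (set_val x) \in @config_set R n.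
Proof.
case: x => x xP; rewrite inE /= => i j ij.
have /= := set_mem xP => /(_ (s i) (s j)); rewrite (inj_eq perm_inj) => /(_ ij).
by apply: contraNneq => /rowP e; apply/eqP/rowP => k; have := e k; rewrite !mxE.
Qed.

Definition config_perm (s : 'S_n) (x : config R n) : config R n :=
  @exist _ (fun x => x \in @config_set R n) _ (config_perm_subproof s x).

Lemma config_permE (s : 'S_n) (x : config R n) (i : 'I_n) :
  row i (set_val (config_perm s x)) = row (s i) (set_val x).
Proof. by apply/rowP => k; rewrite !mxE. Qed.

Lemma config_perm1 (x : config R n) : config_perm 1%g x = x.
Proof. by apply: val_inj => /=; exact: row_perm1. Qed.

Lemma config_permM (s t : 'S_n) (x : config R n) :
  config_perm (s * t)%g x = config_perm s (config_perm t x).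
Proof. by apply: val_inj => /=; exact: row_permM. Qed.

Variable G : {group 'S_n}.

(* [config_perm] is a left or a right action according to the convention used
   for products in ['S_n]; the orbits do not depend on it. *)
Definition same_orbit (x y : config R n) : bool :=
  [exists s in G, y == config_perm s x].

Lemma same_orbit_refl : reflexive same_orbit.
Proof.
by move=> x; apply/exists_inP; exists 1%g; rewrite ?group1// config_perm1.
Qed.

Lemma same_orbit_sym : symmetric same_orbit.
Proof.
suff h x y : same_orbit x y -> same_orbit y x by move=> x y; apply/idP/idP; exact: h.
move=> /exists_inP[s sG /eqP ->]; apply/exists_inP; exists s^-1%g.
  by rewrite groupV.
by rewrite -config_permM mulVg config_perm1.
Qed.

Lemma same_orbit_trans : transitive same_orbit.
Proof.
move=> y x z /exists_inP[s sG /eqP ->] /exists_inP[t tG /eqP ->].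
by apply/exists_inP; exists (t * s)%g; rewrite ?groupM// config_permM.
Qed.

Canonical same_orbit_equiv :=
  EquivRel same_orbit same_orbit_refl same_orbit_sym same_orbit_trans.

Definition config_quotient : Type :=
  quotient_topology {eq_quot same_orbit_equiv}.

HB.instance Definition _ := Topological.on config_quotient.
HB.instance Definition _ := Quotient.on config_quotient.

End ConfigQuotient.

(* Main.v *)
(** The group [G] acts freely and by isometries on the configuration space, so the
   projection to the quotient is a covering and the monodromy of loops gives a
   homomorphism to [G], which is bijective once the configuration space is path
   connected and simply connected. For the latter, a path is homotopic to a nearby
   polygonal path. The diagonals [x_i = x_j] have codimension 3, so for generic [c]
   the cone with apex [c] over a polygonal path, which is two-dimensional, misses
   them. Pushing along the cone deforms the path to the path through [c] made of
   the two segments from its endpoints, which depends only on [c] and the endpoints. *)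
Require Import Defs.
From HB Require Import structures.
From mathcomp Require Import all_boot all_order all_algebra all_fingroup.
From mathcomp Require Import generic_quotient.
From mathcomp Require Import interval_inference.
From mathcomp Require Import all_classical all_reals.
From mathcomp Require Import topology normedtype homotopy continuous_path.
From mathcomp Require Import ring lra.

Set Implicit Arguments.
Unset Strict Implicit.
Unset Printing Implicit Defensive.

Import Order.TTheory GRing.Theory Num.Theory.
Import numFieldNormedType.Exports.

(** * The configuration space and nearby configurations *)

Section MatrixContinuity.
Local Open Scope classical_set_scope.
Local Open Scope ring_scope.
Context {R : realType} {S : topologicalType}.

Lemma mx_continuous m p (f : S -> 'M[R]_(m, p)) :
  (forall i k, continuous (fun s => f s i k)) -> continuous f.
Proof.
move=> cf s U [P nP sP].
have nU : \forall t \near s, forall i k, P i k (f t i k).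
  apply: filter_forall => i; apply: filter_forall => k.
  exact: (cf i k s _ (nP i k)).
by apply: filterS nU => t ht; apply: sP.
Qed.

Lemma entry_continuous m p (f : S -> 'M[R]_(m, p)) i k :
  continuous f -> continuous (fun s => f s i k).
Proof.
by move=> cf; apply: (comp_continuous (g := fun x : 'M[R]_(m, p) => x i k));
  [exact: coord_continuous|].
Qed.

Lemma sumf_continuous (J : Type) (r : seq J) (f : J -> S -> R) :
  (forall j, continuous (f j)) -> continuous (fun s => \sum_(j <- r) f j s).
Proof.
move=> cf; elim: r => [|j r IH].
  under eq_fun do rewrite big_nil.
  by move=> s; exact: cvg_cst.
under eq_fun do rewrite big_cons.
exact: addf_continuous.
Qed.

Lemma absf_continuous (f : S -> R) :
  continuous f -> continuous (fun s => `|f s|).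
Proof. by move=> cf; apply: (comp_continuous (@norm_continuous _ R)). Qed.

Lemma oppf_continuous (f : S -> R) :
  continuous f -> continuous (fun s => - f s).
Proof. by move=> cf s; apply: cvgN; exact: cf. Qed.

End MatrixContinuity.

Section ConfigNear.
Local Open Scope classical_set_scope.
Local Open Scope ring_scope.
Context {R : realType} {n : nat}.
Local Notation X := (config R n).
Local Notation M := 'M[R]_(n, 3).
Implicit Types (x z : M).

Definition cval (x : X) : M := set_val x.

Lemma cval_inj : injective cval.
Proof. by move=> x z; exact: val_inj. Qed.

Lemma cval_continuous : continuous cval.
Proof. exact: initial_continuous. Qed.

Lemma config_continuous (S : topologicalType) (f : S -> X) :
  continuous (fun s => cval (f s)) -> continuous f.
Proof.
move=> cf; apply/continuousP => A [B oB <-].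
by rewrite -comp_preimage; apply: open_comp => // s _; exact: cf.
Qed.

Definition mkconfig x (h : config_set x) : X :=
  @exist M (fun x => x \in @config_set R n) x (mem_set h).

Lemma cval_mkconfig x (h : config_set x) : cval (mkconfig h) = x.
Proof. by []. Qed.

Lemma config_setP x :
  config_set x <-> forall i j, i != j -> exists k, x i k != x j k.
Proof.
split=> h i j ij.
  have := h i j ij; apply: contraNP => /forallNP e.
  by apply/eqP/rowP => k; rewrite !mxE; apply/eqP/negPn/negP/e.
have [k] := h i j ij; apply: contraNneq => /rowP /(_ k).
by rewrite !mxE => ->.
Qed.

Lemma cvalP (a : X) : config_set (cval a).
Proof. by case: a => a aP; exact: set_mem. Qed.

(** The [l^1] distance: it is convex, invariant under simultaneous permutation of the rows, and
    bounds every entry. *)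
Definition dist x z : R := \sum_i \sum_k `|x i k - z i k|.

Lemma distxx x : dist x x = 0.
Proof.
by rewrite /dist big1 // => i _; rewrite big1 // => k _; rewrite subrr normr0.
Qed.

Lemma le_dist x z i k : `|x i k - z i k| <= dist x z.
Proof.
rewrite /dist (bigD1 i) //= (bigD1 k) //= -addrA lerDl addr_ge0 //.
  by rewrite sumr_ge0.
by rewrite sumr_ge0 // => j _; rewrite sumr_ge0.
Qed.

Lemma dist_row_perm s x z : dist (row_perm s x) (row_perm s z) = dist x z.
Proof.
rewrite /dist [RHS](reindex_inj (@perm_inj _ s)) /=.
by apply: eq_bigr => i _; apply: eq_bigr => k _; rewrite !mxE.
Qed.

Lemma dist_conv x z z' (l : R) : 0 <= l <= 1 ->
  dist x ((1 - l) *: z + l *: z') <= (1 - l) * dist x z + l * dist x z'.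
Proof.
move=> /andP[l0 l1].
rewrite /dist !mulr_sumr -big_split /=; apply: ler_sum => i _.
rewrite !mulr_sumr -big_split /=; apply: ler_sum => k _; rewrite !mxE.
have -> : x i k - ((1 - l) * z i k + l * z' i k) =
  (1 - l) * (x i k - z i k) + l * (x i k - z' i k) by ring.
apply: (le_trans (ler_normD _ _)); rewrite !normrM (ger0_norm l0) ger0_norm //.
by rewrite subr_ge0.
Qed.

Lemma dist_continuous (S : topologicalType) (f g : S -> M) :
  continuous f -> continuous g -> continuous (fun s => dist (f s) (g s)).
Proof.
move=> cf cg; apply: sumf_continuous => i; apply: sumf_continuous => k.
apply: absf_continuous; apply: addf_continuous; first exact: entry_continuous.
exact/oppf_continuous/entry_continuous.
Qed.

(* [z] lies in the ball of centre [x] on which no two points collide and which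
   meets each orbit at most once. *)
Definition near_config x z : Prop :=
  forall i j, i != j -> exists k, 2 * dist x z < `|x i k - x j k|.

Lemma near_config_refl x : config_set x -> near_config x x.
Proof.
move=> /config_setP h i j ij; have [k hk] := h i j ij; exists k.
by rewrite distxx mulr0 normr_gt0 subr_eq0.
Qed.

(** If rows [i] and [j] of [z] agreed, each coordinate of [x_i - x_j] would be a difference of two
    numbers of size at most [dist x z], so none could exceed [2 * dist x z]. *)
Lemma near_config_set x z : near_config x z -> config_set z.
Proof.
move=> h; apply/config_setP => i j ij; have [k hk] := h i j ij; exists k.
apply/eqP => e; move: hk; apply/negP; rewrite -leNgt.
have -> : x i k - x j k = (x i k - z i k) - (x j k - z j k) by rewrite e; ring.
apply: (le_trans (ler_normB _ _)).
by have := le_dist x z i k; have := le_dist x z j k; lra.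
Qed.

(** The combination is no farther from [x] than the farther of [z] and [z'], so the coordinate [k]
    that works for that one works for it too. *)
Lemma near_config_conv x z z' (l : R) : 0 <= l <= 1 ->
  near_config x z -> near_config x z' ->
  near_config x ((1 - l) *: z + l *: z').
Proof.
move=> l01 h h' i j ij; have := dist_conv x z z' l01; case/andP: l01 => l0 l1.
have [d|d] := leP (dist x z) (dist x z').
  have [k hk] := h' i j ij; exists k; apply: le_lt_trans hk.
  rewrite ler_pM2l //; nra.
have [k hk] := h i j ij; exists k; apply: le_lt_trans hk.
rewrite ler_pM2l //; nra.
Qed.

Lemma near_config_row_perm s x z :
  near_config x z -> near_config (row_perm s x) (row_perm s z).
Proof.
move=> h i j ij; have [|k hk] := h (s i) (s j); first by rewrite (inj_eq perm_inj).
by exists k; rewrite dist_row_perm !mxE.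
Qed.

(** If [s] moves [i], row [s i] of [z] is row [i] of [row_perm s z], so every coordinate of
    [x_(s i) - x_i] is at most the sum of the two distances. Nearness makes this sum exceed twice
    either distance, which is absurd. *)
Lemma near_config_row_perm_eq1 s x z :
  near_config x z -> near_config x (row_perm s z) -> s = 1%g.
Proof.
move=> h h'; apply/permP => i; rewrite perm1; apply/eqP/negPn/negP => si.
suff : 2 * dist x z < dist x z + dist x (row_perm s z) /\
       2 * dist x (row_perm s z) < dist x z + dist x (row_perm s z) by lra.
have key k : `|x (s i) k - x i k| <= dist x z + dist x (row_perm s z).
  have -> : x (s i) k - x i k =
    (x (s i) k - z (s i) k) - (x i k - row_perm s z i k) by rewrite !mxE; ring.
  apply: (le_trans (ler_normB _ _)); apply: lerD; exact: le_dist.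
by split; [have [k hk] := h _ _ si | have [k hk] := h' _ _ si];
  exact: lt_le_trans (key k).
Qed.

(** Centre and point move together. The coordinate chosen for a pair [i], [j] at [s] still works
    nearby, and there are finitely many pairs. *)
Lemma near_config_open (S : topologicalType) (f g : S -> M) s :
  continuous f -> continuous g -> near_config (f s) (g s) ->
  \forall t \near s, near_config (f t) (g t).
Proof.
move=> cf cg h.
suff : \forall t \near s, forall i j, i != j ->
    exists k, 2 * dist (f t) (g t) < `|f t i k - f t j k| by apply: filterS.
apply: filter_forall => i; apply: filter_forall => j.
have [->|ij] := eqVneq i j; first by apply: filterS filterT => t _ /eqP.
have [k hk] := h i j ij.
pose e t := `|f t i k - f t j k| - 2 * dist (f t) (g t).
have ce : continuous e.
  apply: addf_continuous.
    apply: absf_continuous; apply: addf_continuous; first exact: entry_continuous.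
    exact/oppf_continuous/entry_continuous.
  exact/oppf_continuous/mulc_continuous/dist_continuous.
have : \forall t \near s, 0 < e t.
  apply: (ce s [set r | 0 < r]); apply: open_nbhs_nbhs; split; first exact: open_gt.
  by rewrite /= subr_gt0.
by apply: filterS => t; rewrite subr_gt0 => ht _; exists k.
Qed.

End ConfigNear.

(** * The covering by the configuration space *)

Section Covering.
Local Open Scope classical_set_scope.
Local Open Scope ring_scope.
Local Open Scope quotient_scope.
Context {R : realType} {n : nat} (G : {group 'S_n}).
Local Notation X := (config R n).
Local Notation B := (config_quotient R G).
Local Notation I := (unit_interval R).
Implicit Types (x z : X).

Definition orbit_pi x : B := \pi_B x.
Local Notation q := orbit_pi.

Lemma orbit_pi_continuous : continuous q.
Proof. exact: pi_continuous. Qed.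

Lemma orbit_piP x z : q x = q z <-> exists2 s, s \in G & z = config_perm s x.
Proof.
have e : q x = q z <-> same_orbit G x z.
  split=> [h|h]; first exact: (introT (eqmodP (same_orbit_equiv R G) x z) h).
  exact: (elimT (eqmodP (same_orbit_equiv R G) x z) h).
split=> [/e /exists_inP[s sG /eqP ->]|[s sG zE]]; first by exists s.
by apply/e/exists_inP; exists s => //; apply/eqP.
Qed.

Lemma orbit_pi_repr (b : B) : q (repr b) = b.
Proof. exact: reprK. Qed.

Lemma cval_config_perm s x : cval (config_perm s x) = row_perm s (cval x).
Proof. by []. Qed.

Lemma config_perm_continuous s : continuous (@config_perm R n s).
Proof.
apply: config_continuous; apply: mx_continuous => i k.
under eq_fun do rewrite cval_config_perm mxE.
exact/entry_continuous/cval_continuous.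
Qed.

(** The saturation of an open set is the union of its preimages under the permutations in [G], hence
    open. *)
Lemma orbit_pi_open (x : X) (U : set X) : nbhs x U -> nbhs (q x) (q @` U).
Proof.
rewrite nbhsE => -[V [oV Vx] VU].
have oqV : open (q @` V).
  suff -> : open (q @` V) = open (\bigcup_(s in [set s | s \in G])
     ((@config_perm R n s) @^-1` V)).
    apply: bigcup_open => s _; apply: open_comp => // z _.
    exact: config_perm_continuous.
  (* Openness in the quotient topology unfolds to openness of the preimage. *)
  rewrite {1}/open /=; congr open; apply/seteqP; split=> z /=.
    by move=> [v Vv] /esym /orbit_piP[s sG e]; exists s => //=; rewrite -e.
  move=> [s sG Vs]; exists (config_perm s z) => //.
  by apply/esym/orbit_piP; exists s.
apply: (@filterS _ _ _ (q @` V)); first exact: image_subset.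
by apply: open_nbhs_nbhs; split => //; exists x.
Qed.

(** Injectivity of the projection on each ball plays the part of evenly covered neighbourhoods. *)
Lemma near_lift_uniq x z z' : near_config (cval x) (cval z) ->
  near_config (cval x) (cval z') -> q z = q z' -> z = z'.
Proof.
move=> h h' /orbit_piP[s _ e]; move: h'; rewrite e cval_config_perm.
by move=> /(near_config_row_perm_eq1 h) ->; rewrite config_perm1.
Qed.

(** Arbitrary pointwise choices of nearby lifts are continuous: the projection being open, [h t] for
    [t] near [s] has a lift close to [F s], and by [near_lift_uniq] that lift is [F t]. *)
Lemma near_lift (S : topologicalType) (F0 : S -> X) (h : S -> B) :
  continuous F0 -> continuous h ->
  (forall s, exists z, q z = h s /\ near_config (cval (F0 s)) (cval z)) ->
  exists F : S -> X, [/\ continuous F, forall s, q (F s) = h s &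
    forall s, near_config (cval (F0 s)) (cval (F s))].
Proof.
move=> cF0 ch /choice[F FE]; exists F; split=> [|s|s]; [|exact: (FE s).1|exact: (FE s).2].
move=> s U nU.
have [qF nF] := FE s.
have [[A C] /= [nA nC] AC] : \forall p \near (F0 s, F s),
    near_config (cval p.1) (cval p.2).
  apply: (near_config_open (f := fun p : X * X => cval p.1)
    (g := fun p : X * X => cval p.2)) => //.
  - apply: comp_continuous; [exact: cval_continuous | move=> p; exact: cvg_fst].
  - apply: comp_continuous; [exact: cval_continuous | move=> p; exact: cvg_snd].
have hU : nbhs s (h @^-1` (q @` (U `&` C))).
  by apply: ch; rewrite -qF; apply: orbit_pi_open; exact: filterI.
have hA : nbhs s (F0 @^-1` A) by exact: cF0.
apply: filterS2 hU hA => t [z [Uz Cz] qz] At.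
have [qFt nFt] := FE t.
rewrite /= (@near_lift_uniq (F0 t) (F t) z) ?qFt //.
exact: (AC (F0 t, z)).
Qed.

End Covering.

(** * Uniform subdivision of the unit square *)

Section Lebesgue.
Local Open Scope classical_set_scope.
Local Open Scope ring_scope.
Context {R : realType}.

(** A Lebesgue number argument: compactness of the square turns the local radii into one step length
    in the second variable. *)
Lemma uniform_subdivision (P : R -> R -> R -> Prop) :
  (forall s t, exists2 r : R, 0 < r & forall s' t' t'',
     `|s - s'| < r -> `|t - t'| < r -> `|t - t''| < r -> P s' t' t'') ->
  exists N : nat, forall s t t', 0 <= s <= 1 -> 0 <= t <= 1 ->
    `|t - t'| <= N.+1%:R^-1 -> P s t t'.
Proof.
move=> hP.
have cK : compact ((`[0 : R, 1] : set R) `*` (`[0 : R, 1] : set R)).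
  by apply: compact_setX; exact: segment_compact.
have := (compact_near_coveringP _).1 cK nat \oo
  (fun N st => forall t', `|st.2 - t'| <= N.+1%:R^-1 -> P st.1 st.2 t') _.
case=> [|N _ hN]; last first.
  exists N => s t t' s01 t01; apply: (hN N _ (s, t)) => //=.
move=> [s t] _ /=; have [r r0 hr] := hP s t.
have r20 : 0 < r / 2 by rewrite divr_gt0.
(* Halving [r] leaves room for the third argument of [P], which is close to [t] only by way of the
   second. *)
exists ((ball s (r / 2) `*` ball t (r / 2)), [set N | N.+1%:R^-1 < r / 2]) => /=.
  split; first by exists (ball s (r / 2), ball t (r / 2)) => //=; split; exact: nbhsx_ballx.
  exact: (near_infty_natSinv_lt (PosNum r20)).
move=> [[s' t'] N] /= [[bs bt] hN] t'' ht.
apply: hr; rewrite /ball /= in bs bt ht hN *; try by rewrite (lt_trans bs, lt_trans bt) // ltr_pdivrMr // ltr_pMr // ltr1n.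
have -> : t - t'' = (t - t') + (t' - t'') by ring.
by rewrite (le_lt_trans (ler_normD _ _)) // (splitr r) ltrD // (le_lt_trans ht).
Qed.

End Lebesgue.

(** * Existence and uniqueness of lifts *)

Section Lifting.
Local Open Scope classical_set_scope.
Local Open Scope ring_scope.
Context {R : realType} {n : nat} (G : {group 'S_n}).
Local Notation X := (config R n).
Local Notation B := (config_quotient R G).
Local Notation I := (unit_interval R).
Local Notation q := (@orbit_pi R n G).

(** Lifts [z1], [z2] taken close to the chosen lift [x] are near each other. Any lift [z] is a
    translate of [z1] by some [g], and the same [g] carries [z2] to a point near [z], so the step
    length does not depend on [z]. *)
Lemma lift_continue (h : R * R -> B) : continuous h ->
  exists N : nat, forall s t t', 0 <= s <= 1 -> 0 <= t <= 1 ->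
    `|t - t'| <= N.+1%:R^-1 ->
    forall z, q z = h (s, t) ->
    exists z', q z' = h (s, t') /\ near_config (cval z) (cval z').
Proof.
move=> ch; apply: (@uniform_subdivision R (fun s t t' => forall z, q z = h (s, t) ->
    exists z', q z' = h (s, t') /\ near_config (cval z) (cval z'))) => s t.
pose x : X := repr (h (s, t)).
have [[A C] /= [nA nC] AC] : \forall p \near (x, x),
    near_config (cval p.1) (cval p.2).
  apply: (near_config_open (f := fun p : X * X => cval p.1)
    (g := fun p : X * X => cval p.2)).
  - apply: comp_continuous; [exact: cval_continuous | move=> p; exact: cvg_fst].
  - apply: comp_continuous; [exact: cval_continuous | move=> p; exact: cvg_snd].
  - exact/near_config_refl/cvalP.
have : nbhs (s, t) (h @^-1` (q @` (A `&` C))).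
  by apply: ch; rewrite -(orbit_pi_repr (h (s, t))); apply: orbit_pi_open; exact: filterI.
case/nbhs_ballP => r /= r0 br; exists r => // s' t' t'' hs ht' ht'' z.
have [|z1 [Az1 _] <-] := br (s', t'); first by split.
have [|z2 [_ Cz2] <-] := br (s', t''); first by split.
move=> /esym/orbit_piP[g gG ->]; exists (config_perm g z2); split.
  by apply/esym/orbit_piP; exists g.
by apply: near_config_row_perm; exact: (AC (z1, z2)).
Qed.

(** The lift is built strip by strip in the second variable, with strips thin enough for
    [lift_continue]. *)
Lemma homotopy_lifting (h : I * I -> B) (x : X) : continuous h ->
  (forall s, h (s, zero) = q x) ->
  exists F : I * I -> X, [/\ continuous F, forall s, F (s, zero) = x &
    forall p, q (F p) = h p].
Proof.
move=> ch h0.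
have c1 (U V : topologicalType) : continuous (@fst U V) by move=> p; exact: cvg_fst.
have c2 (U V : topologicalType) : continuous (@snd U V) by move=> p; exact: cvg_snd.
have [N hN] : exists N : nat, forall s t t', 0 <= s <= 1 -> 0 <= t <= 1 ->
    `|t - t'| <= N.+1%:R^-1 ->
    forall z, q z = h (clamp s, clamp t) ->
    exists z', q z' = h (clamp s, clamp t') /\ near_config (cval z) (cval z').
  apply: (@lift_continue (fun p => h (clamp p.1, clamp p.2))).
  apply: (comp_continuous ch).
  by apply: pair_continuous; apply: (comp_continuous (@clamp_continuous R));
    [exact: c1 | exact: c2].
(* Partial lifts are total continuous maps on [I * R], so they can be pasted; they have to cover [h]
   only up to the [k]-th grid line. *)
suff grid k : (k <= N.+1)%N -> exists F : I * R -> X, [/\ continuous F,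
    forall s t, t <= 0 -> F (s, t) = x &
    forall s t, t <= k%:R / N.+1%:R -> q (F (s, t)) = h (s, clamp t)].
  have [F [cF F0 qF]] := grid N.+1 (leqnn _).
  exists (fun p => F (p.1, ival p.2)); split => [|s|[s t]] /=.
  - apply: (comp_continuous cF); apply: pair_continuous; first exact: c1.
    by apply: (comp_continuous (@ival_continuous R)); exact: c2.
  - by rewrite F0 // ival0.
  - rewrite qF ?ivalK // divff ?pnatr_eq0 //.
    by have /andP[] := ival_itv t.
elim: k => [_|k IH kN].
  exists (fun=> x); split => // [|s t]; first by move=> p; exact: cvg_cst.
  by rewrite mul0r => t0; rewrite clamp_le0 // h0.
have [F [cF F0 qF]] := IH (ltnW kN).
set a : R := k%:R / N.+1%:R in qF.
set b : R := k.+1%:R / N.+1%:R.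
have ab : b = a + N.+1%:R^-1 by rewrite /a /b -addn1 natrD mulrDl mul1r.
have D0 : 0 < N.+1%:R^-1 :> R by rewrite invr_gt0.
have a0 : 0 <= a by rewrite divr_ge0.
have a1 : a <= 1 by rewrite ler_pdivrMr // mul1r ler_nat ltnW.
(* Clamping time to [[a, b]] keeps it within one grid step of [a], so that nearby lifts exist for
   every real [t]. *)
pose m (t : R) := Num.max a (Num.min t b).
have [F' [cF' qF' nF']] : exists F' : I * R -> X, [/\ continuous F',
    forall p, q (F' p) = h (p.1, clamp (m p.2)) &
    forall p, near_config (cval (F (p.1, a))) (cval (F' p))].
  apply: (near_lift (F0 := fun p => F (p.1, a))
    (h := fun p : I * R => h (p.1, clamp (m p.2)))).
  - apply: (comp_continuous cF); apply: pair_continuous; first exact: c1.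
    by move=> p; exact: cvg_cst.
  - apply: (comp_continuous ch); apply: pair_continuous; first exact: c1.
    apply: (comp_continuous (@clamp_continuous R)).
    apply: maxf_continuous; first by move=> p; exact: cvg_cst.
    by apply: minf_continuous; [exact: c2 | move=> p; exact: cvg_cst].
  - move=> [s t] /=.
    have [||||z' [qz' nz']] := hN (ival s) a (m t) _ _ _ (F (s, a)).
    + exact: ival_itv.
    + by rewrite a0.
    + have h1 : a <= m t by rewrite le_max lexx.
      have h2 : m t <= b by rewrite ge_max ge_min lexx orbT andbT ab lerDl ltW.
      by rewrite distrC ger0_norm ?subr_ge0 // lerBlDl -ab.
    + by rewrite ivalK qF.
    + by exists z'; rewrite -{1}(ivalK s).
(* On the line [t = a] both maps lie over the same point and near [F (s, a)], so they agree and can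
   be pasted. *)
have F'a s : F' (s, a) = F (s, a).
  apply: (near_lift_uniq (G := G) (nF' (s, a))); first exact/near_config_refl/cvalP.
  by rewrite qF' qF //= /m min_l ?maxxx // ab lerDl ltW.
exists (fun p => if p.2 <= a then F p else F' p); split => [|s t t0|s t tb] /=.
- apply: paste_continuous => //; first exact: c2.
  by move=> [s t] /= ->; rewrite F'a.
- by rewrite (le_trans t0 a0) F0.
- case: leP => [ta|at_]; first exact: qF.
  by rewrite qF' /= /m min_l // max_r // ltW.
Qed.

(** Extended to the real line by [clamp], the lifts agree on a set that is open by [near_lift_uniq]
    and closed by continuity of [dist]; connectedness of the segment concludes. *)
Lemma lift_uniq (F F' : I -> X) : continuous F -> continuous F' ->
  (forall t, q (F t) = q (F' t)) -> F zero = F' zero -> F =1 F'.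
Proof.
move=> cF cF' qF F0 t.
pose f t := F (clamp t); pose f' t := F' (clamp t).
have cf : continuous f by exact: (comp_continuous cF (@clamp_continuous R)).
have cf' : continuous f' by exact: (comp_continuous cF' (@clamp_continuous R)).
pose E := [set t | f t = f' t].
have oE : open E.
  rewrite openE => s /= Es.
  have near_s (g : R -> X) : continuous g -> f s = g s ->
      \forall u \near s, near_config (cval (f s)) (cval (g u)).
    move=> cg e; apply: (near_config_open (f := fun=> cval (f s)) (g := fun u => cval (g u))).
    - by move=> u; exact: cvg_cst.
    - by apply: comp_continuous => //; exact: cval_continuous.
    - by rewrite -e; exact/near_config_refl/cvalP.
  have nf := near_s f cf erefl; have nf' := near_s f' cf' Es.
  apply: filterS2 nf nf' => u h h'.
  exact: (near_lift_uniq (G := G) h h' (qF _)).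
have cE : closed E.
  have -> : E = ~` [set t | 0 < dist (cval (f t)) (cval (f' t))].
    apply/seteqP; split => s /=; first by rewrite /E /= => ->; rewrite distxx ltxx.
    move=> /negP; rewrite -leNgt => d0; apply: cval_inj; apply/matrixP => i k.
    apply/eqP; rewrite -subr_eq0 -normr_le0; apply: le_trans d0.
    exact: le_dist.
  apply: open_closedC.
  apply: (@open_comp _ _ (fun t => dist (cval (f t)) (cval (f' t))) [set r | 0 < r]) => [s _|].
    by apply: dist_continuous; apply: comp_continuous => //; exact: cval_continuous.
  exact: open_gt.
have e : `[0, 1]%classic `&` E = `[0, 1]%classic.
  apply: (@segment_connected R 0 1).
  - by exists 0; split; [rewrite /= in_itv /= lexx ler01 | exact: F0].
  - by exists E.
  - by exists E.
suff : (`[0, 1]%classic `&` E) (ival t) by case=> _; rewrite /E /f /f' /= ivalK.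
by rewrite e /= in_itv /=; exact: ival_itv.
Qed.

End Lifting.

(** * Generic cones and polygonal paths *)

Section GenericCone.
Local Open Scope ring_scope.
Context {R : realType}.

(** A 3 by 2 matrix has a nonzero left kernel. This is where dimension 3 enters: two vectors do not
    span the space. *)
Lemma plane_normal (u v : 'I_3 -> R) : exists w : 'rV[R]_3,
  [/\ w != 0, \sum_k w 0 k * u k = 0 & \sum_k w 0 k * v k = 0].
Proof.
pose A : 'M[R]_(3, 2) := \matrix_(k, j) (if j == 0 then u k else v k).
have /rowV0Pn[w /sub_kermxP wA w0] : kermx A != 0.
  rewrite -mxrank_eq0 mxrank_ker subn_eq0 -ltnNge.
  by rewrite ltnS (leq_trans (rank_leq_col A)).
exists w; split => //.
  have /rowP/(_ 0) := wA; rewrite !mxE => e; rewrite -[RHS]e.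
  by apply: eq_bigr => k _; rewrite mxE.
have /rowP/(_ 1) := wA; rewrite !mxE => e; rewrite -[RHS]e.
by apply: eq_bigr => k _; rewrite mxE.
Qed.

(** Among the [size p] numbers [0, 1, ...], distinct in [R], not all can be roots. *)
Lemma exists_nonroot (p : {poly R}) : p != 0 -> exists x, p.[x] != 0.
Proof.
move=> p0; apply: contrapT => h.
have := @max_poly_roots _ p [seq i%:R | i <- iota 0 (size p)] p0.
rewrite size_map size_iota ltnn => /(_ _ _)/negP; apply => //.
- apply/allP => x _; apply/rootP/eqP/negPn/negP => px; apply: h; by exists x.
- rewrite map_inj_uniq ?iota_uniq //.
  by move=> i j /eqP; rewrite eqr_nat => /eqP.
Qed.

(* The exponents [3 * i + k] of the moment curve are pairwise distinct, so that no
   cancellation occurs. *)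
Definition moment_poly (i j : nat) (w : 'rV[R]_3) : {poly R} :=
  \sum_k (w 0 k)%:P * ('X^(3 * i + k) - 'X^(3 * j + k)).

Lemma moment_poly_neq0 i j w : i != j -> w != 0 -> moment_poly i j w != 0.
Proof.
move=> ij; apply: contraNneq => p0; apply/eqP/rowP => k; rewrite mxE.
have := congr1 (fun p : {poly R} => p`_(3 * i + k)) p0.
rewrite /moment_poly coef_sum coef0 (bigD1 k) //= big1 => [|k' k'k].
  rewrite coefCM coefB !coefXn eqxx addr0.
  have /negPf -> : (3 * i + k)%N != (3 * j + k)%N.
    by rewrite eqn_add2r eqn_mul2l.
  by rewrite subr0 mulr1.
rewrite coefCM coefB !coefXn eqn_add2l.
have /negPf -> : k != k' :> nat by rewrite eq_sym.
suff /negPf -> : (3 * i + k)%N != (3 * j + k')%N by rewrite subrr mulr0.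
apply: contraNneq ij => e; have := congr1 (divn^~ 3) e.
by rewrite !(mulnC 3) !divnMDl // !divn_small // !addn0 => ->.
Qed.

Lemma horner_moment_poly i j w T : (moment_poly i j w).[T] =
  \sum_k w 0 k * (T ^+ (3 * i + k) - T ^+ (3 * j + k)).
Proof.
rewrite /moment_poly horner_sum; apply: eq_bigr => k _.
by rewrite !hornerE.
Qed.

(* The triangle spanned by [c], [a] and [b] meets the diagonal [x_i = x_j] off
   [[a, b]] only if [c_i - c_j] is in the plane spanned by [a_i - a_j] and
   [b_i - b_j]; a point [c] with all its points on a moment curve avoids finitely
   many planes. *)
Lemma generic_cone n (s : seq ('M[R]_(n, 3) * 'M[R]_(n, 3))) :
  exists c : 'M[R]_(n, 3), forall a b, (a, b) \in s -> forall l y,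
    config_set ((1 - l) *: a + l *: b) ->
    config_set ((1 - y) *: ((1 - l) *: a + l *: b) + y *: c).
Proof.
have /choice[w wP] (abij : ('M[R]_(n, 3) * 'M[R]_(n, 3)) * ('I_n * 'I_n)) :
    exists w : 'rV[R]_3, let: ((a, b), (i, j)) := abij in
    [/\ w != 0, \sum_k w 0 k * (a i k - a j k) = 0 &
        \sum_k w 0 k * (b i k - b j k) = 0].
  by case: abij => -[a b] [i j]; exact: plane_normal.
(* A non-root of this product puts the moment-curve configuration off all the planes at once. *)
pose P : {poly R} := \prod_(ab <- s) \prod_(i : 'I_n) \prod_(j : 'I_n | i != j)
   moment_poly i j (w (ab, (i, j))).
have /exists_nonroot[T] : P != 0.
  rewrite prodf_seq_neq0; apply/allP => -[a b] _ /=.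
  apply/prodf_neq0 => i _; apply/prodf_neq0 => j ij.
  by apply: moment_poly_neq0; [exact: ij | case: (wP ((a, b), (i, j)))].
rewrite horner_prod prodf_seq_neq0 => /allP PT.
exists (\matrix_(i, k) T ^+ (3 * i + k)) => a b abs l y /config_setP h.
apply/config_setP => i j ij; apply: contrapT => /forallNP hk.
have {PT} := PT _ abs; rewrite /= horner_prod => /prodf_neq0 /(_ i isT).
rewrite horner_prod => /prodf_neq0 /(_ j ij); rewrite horner_moment_poly.
have [_] := wP ((a, b), (i, j)); set v := w _ => va vb.
set S := \sum_k _ => S0.
(* Here rows [i] and [j] of the cone point are assumed equal. Pairing their difference with the
   normal [v] kills the contribution of [a] and [b]; as [S] is nonzero, [y = 0] and the point lies
   on the base, where the rows differ. *)
have yS : y * S = 0.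
  transitivity (\sum_k v 0 k * (y * (T ^+ (3 * i + k) - T ^+ (3 * j + k)))
     + (1 - y) * ((1 - l) * \sum_k v 0 k * (a i k - a j k)
                  + l * \sum_k v 0 k * (b i k - b j k))).
    rewrite va vb !mulr0 addr0 mulr0 addr0 /S mulr_sumr.
    by apply: eq_bigr => k _; ring.
  rewrite !mulr_sumr -big_split mulr_sumr -big_split /= big1 // => k _.
  have /negP/negPn/eqP := hk k; rewrite !mxE => e.
  rewrite -[RHS](mulr0 (v 0 k)) -[X in _ = _ * X](subrr
    ((1 - y) * ((1 - l) * a j k + l * b j k) + y * T ^+ (3 * j + k))) -{1}e.
  by ring.
move/eqP: yS; rewrite mulf_eq0 (negPf S0) orbF => /eqP y0.
have [k] := h i j ij; apply/negP.
by move: (hk k) => /negP; rewrite y0 subr0 scale1r scale0r addr0.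
Qed.

End GenericCone.

Section PiecewiseLinear.
Local Open Scope classical_set_scope.
Local Open Scope ring_scope.
Context {R : realType} {m p : nat}.
Variables (v : nat -> 'M[R]_(m, p)) (N : nat).

(** The polygonal path with vertex [v k] at time [k / N]: the [j]-th increment is switched on
    linearly between times [j / N] and [(j + 1) / N]. The closed formula gives continuity without
    pasting. *)
Definition pl (t : R) : 'M[R]_(m, p) :=
  v 0 + \sum_(j < N) Num.max 0 (Num.min 1 (N%:R * t - j%:R)) *: (v j.+1 - v j).

Lemma pl_continuous : continuous pl.
Proof.
apply: mx_continuous => i k.
under eq_fun do rewrite mxE summxE.
apply: addf_continuous; first by move=> t; exact: cvg_cst.
apply: sumf_continuous => j.
under eq_fun do rewrite mxE.
apply: mulf_continuous; last by move=> t; exact: cvg_cst.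
apply: maxf_continuous; first by move=> t; exact: cvg_cst.
apply: minf_continuous; first by move=> t; exact: cvg_cst.
by apply: subc_continuous; apply: mulc_continuous => t; exact: cvg_id.
Qed.

Lemma pl_segment (k : nat) (l : R) (t : R) : (k < N)%N -> 0 <= l <= 1 ->
  N%:R * t = k%:R + l -> pl t = (1 - l) *: v k + l *: v k.+1.
Proof.
move=> kN /andP[l0 l1] tE.
(* Increments before the [k]-th are complete and telescope to [v k - v 0], later ones have not
   begun, and the [k]-th has weight [l]. *)
have coef j : Num.max 0 (Num.min 1 (N%:R * t - j%:R)) =
    if (j < k)%N then 1 else if j == k then l else 0.
  rewrite tE; case: ltngtP => [jk|kj|->].
  - have : j%:R + 1 <= k%:R :> R by rewrite natr1 ler_nat.
    by move=> h; rewrite min_l ?max_r //; lra.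
  - have : k%:R + 1 <= j%:R :> R by rewrite natr1 ler_nat.
    by move=> h; rewrite min_r ?max_l //; lra.
  - by rewrite (_ : k%:R + l - k%:R = l) ?min_r ?max_r //; lra.
rewrite /pl (eq_bigr (fun j : 'I_N => (if (j < k)%N then 1 else if j == k :> nat then l else 0)
   *: (v j.+1 - v j))); last by move=> j _; rewrite coef.
rewrite -(big_mkord xpredT (fun j => (if (j < k)%N then 1 else if j == k then l else 0)
   *: (v j.+1 - v j))).
rewrite (@big_cat_nat _ _ _ k) //=; last exact: ltnW.
rewrite (@eq_big_nat _ _ _ 0 k _ (fun j => v j.+1 - v j)); last first.
  by move=> j /andP[_ jk]; rewrite jk scale1r.
rewrite telescope_sumr // (@big_ltn _ _ _ k) // ltnn eqxx big_nat_cond big1; last first.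
  move=> j /andP[/andP[kj _] _].
  by rewrite ltnNge (ltnW kj) /= gtn_eqF // scale0r.
rewrite addr0; apply/matrixP => i j; rewrite !mxE; ring.
Qed.

End PiecewiseLinear.

(** Closed unit intervals let the right endpoint belong to the last one, so that [k] stays below
    [N.+1]. *)
Lemma unit_subdivision (R : realType) (N : nat) (t : R) :
  (0 <= t <= N.+1%:R)%R ->
  exists k, (k < N.+1)%N /\ (0 <= t - k%:R <= 1)%R.
Proof.
elim: N => [|N IH] /andP[t0 tN]; first by exists 0%N; rewrite subr0 t0.
have [h|h] := lerP t N.+1%:R.
  by have [|k [kN hk]] := IH; [rewrite t0 | exists k; rewrite ltnW].
exists N.+1; split => //; rewrite subr_ge0 (ltW h) lerBlDr.
by rewrite -natr1 in tN; rewrite addrC.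
Qed.

(** * Simple connectivity of the configuration space *)

Section SimplyConnected.
Local Open Scope classical_set_scope.
Local Open Scope ring_scope.
Context {R : realType}.
Local Notation I := (unit_interval R).

Lemma path_of_continuous (T : topologicalType) (a b : T) (f : I -> T) :
  continuous f -> f zero = a -> f one = b ->
  exists p : {path I from a to b}, forall t, p t = f t.
Proof.
move=> cf f0 f1.
by exists (mk_path cf f0 f1).
Qed.

Context {n : nat}.
Local Notation X := (config R n).
Local Notation M := 'M[R]_(n, 3).

Lemma mx_affine_continuous (S : topologicalType) (f g : S -> R) (x y : S -> M) :
  continuous f -> continuous g -> continuous x -> continuous y ->
  continuous (fun s => f s *: x s + g s *: y s).
Proof.
move=> cf cg cx cy; apply: mx_continuous => i k.
under eq_fun do rewrite !mxE.
by apply: addf_continuous; apply: mulf_continuous => //; exact: entry_continuous.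
Qed.

Lemma homotopic_config (a b : X) (p r : {path I from a to b}) (H : I * I -> M) :
  continuous H -> (forall ts, config_set (H ts)) ->
  (forall t, H (t, zero) = cval (p t)) -> (forall t, H (t, one) = cval (r t)) ->
  (forall s, H (zero, s) = cval a) -> (forall s, H (one, s) = cval b) ->
  homotopic p r.
Proof.
move=> cH hH H0 H1 Ha Hb; exists (fun ts => mkconfig (hH ts)).
split=> [|t|t|s|s]; first exact: config_continuous.
- by apply: cval_inj; rewrite cval_mkconfig H0.
- by apply: cval_inj; rewrite cval_mkconfig H1.
- by apply: cval_inj; rewrite cval_mkconfig Ha.
- by apply: cval_inj; rewrite cval_mkconfig Hb.
Qed.

(** The path runs straight from [a] to [c] on the first third, rests at [c] on the middle third, and
    runs straight to [b] on the last. *)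
Definition broken (a c b : M) (t : R) : M :=
  c + (Num.max 0 (1 - 3 * t) *: (a - c) + Num.max 0 (3 * t - 2) *: (b - c)).

Lemma broken_continuous a c b : continuous (broken a c b).
Proof.
have c3 : continuous (fun t : R => 3 * t).
  by apply: mulc_continuous => t; exact: cvg_id.
have -> : broken a c b = fun t => 1 *: c + 1 *:
  (Num.max 0 (1 - 3 * t) *: (a - c) + Num.max 0 (3 * t - 2) *: (b - c)).
  by apply/funext => t; rewrite !scale1r.
apply: mx_affine_continuous; try by move=> t; exact: cvg_cst.
apply: mx_affine_continuous; try by move=> t; exact: cvg_cst.
- apply: maxf_continuous; first by move=> t; exact: cvg_cst.
  exact: csub_continuous.
- apply: maxf_continuous; first by move=> t; exact: cvg_cst.
  exact: subc_continuous.
Qed.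

(* [u |-> broken_time u t] deforms the identity into the reparametrisation that
   stays at the endpoints outside [[1/3, 2/3]], and [u |-> broken_height u t]
   raises the path to the apex of the cone. *)
Definition broken_time (u t : R) : R :=
  (1 - u) * t + u * Num.max 0 (Num.min 1 (3 * t - 1)).

Definition broken_height (u t : R) : R :=
  u * Num.min (3 * t) (Num.min 1 (3 - 3 * t)).

(** On the outer thirds the time stays at [0] or [1] while the height varies; on the middle third
    the height is [1] and [L] drops out. So only the end values of [L] remain. *)
Lemma brokenE (L : R -> M) c (t : R) : 0 <= t <= 1 ->
  (1 - broken_height 1 t) *: L (broken_time 1 t) + broken_height 1 t *: c =
  broken (L 0) c (L 1) t.
Proof.
move=> /andP[t0 t1]; rewrite /broken_height /broken_time /broken.
have [h1|h1] := lerP t 3^-1.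
  have -> : Num.min (3 * t) (Num.min 1 (3 - 3 * t)) = 3 * t.
    by rewrite min_l // le_min; apply/andP; split; lra.
  have -> : Num.max 0 (Num.min 1 (3 * t - 1)) = 0 :> R.
    by rewrite max_l // ge_min; apply/orP; right; lra.
  have -> : Num.max 0 (1 - 3 * t) = 1 - 3 * t by rewrite max_r //; lra.
  have -> : Num.max 0 (3 * t - 2) = 0 by rewrite max_l //; lra.
  rewrite subrr mul0r add0r mulr0.
  by apply/matrixP => i k; rewrite !mxE; ring.
have [h2|h2] := lerP t (2 / 3).
  have -> : Num.min (3 * t) (Num.min 1 (3 - 3 * t)) = 1.
    by rewrite (min_l (x := 1)) ?min_r //; lra.
  have -> : Num.max 0 (1 - 3 * t) = 0 by rewrite max_l //; lra.
  have -> : Num.max 0 (3 * t - 2) = 0 by rewrite max_l //; lra.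
  by rewrite mulr1 subrr !scale0r scale1r add0r !addr0.
have -> : Num.min (3 * t) (Num.min 1 (3 - 3 * t)) = 3 - 3 * t.
  by rewrite (min_r (x := 1)) ?min_r //; lra.
have -> : Num.max 0 (Num.min 1 (3 * t - 1)) = 1 :> R.
  by rewrite (min_l (x := 1)) ?max_r ?ler01 //; lra.
have -> : Num.max 0 (1 - 3 * t) = 0 by rewrite max_l //; lra.
have -> : Num.max 0 (3 * t - 2) = 3 * t - 2 by rewrite max_r //; lra.
rewrite subrr mul0r add0r mulr1.
by apply/matrixP => i k; rewrite !mxE; ring.
Qed.

Lemma broken_time0 (u : R) : broken_time u 0 = 0.
Proof.
rewrite /broken_time max_l; last by rewrite ge_min; apply/orP; right; lra.
by rewrite !mulr0 addr0.
Qed.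

Lemma broken_time1 (u : R) : broken_time u 1 = 1.
Proof.
rewrite /broken_time min_l; last lra.
by rewrite max_r ?ler01 // !mulr1 subrK.
Qed.

Lemma broken_height0 (u : R) : broken_height u 0 = 0.
Proof.
rewrite /broken_height min_l; first by rewrite !mulr0.
by rewrite le_min; apply/andP; split; lra.
Qed.

Lemma broken_height1 (u : R) : broken_height u 1 = 0.
Proof.
rewrite /broken_height (min_r (x := 1)); last lra.
by rewrite min_r ?mulr1 ?subrr ?mulr0 //; lra.
Qed.

(** With [y] ranging over all reals, heights need no bounds. *)
Definition cone_ok (L : R -> M) (c : M) : Prop :=
  forall t y, 0 <= t <= 1 -> config_set ((1 - y) *: L t + y *: c).

Lemma exists_broken_path (a b : X) c :
  (forall y, config_set ((1 - y) *: cval a + y *: c)) ->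
  (forall y, config_set ((1 - y) *: cval b + y *: c)) ->
  exists r : {path I from a to b},
    forall t, cval (r t) = broken (cval a) c (cval b) (ival t).
Proof.
move=> ha hb.
have h t : config_set (broken (cval a) c (cval b) (ival t)).
  (* [brokenE] asks for no continuity, so a two-valued [L] places each point of the broken path on a
     line joining [c] to an endpoint. *)
  pose L (s : R) := if s <= 2^-1 then cval a else cval b.
  have L0 : L 0 = cval a by rewrite /L invr_ge0 ler0n.
  have L1 : L 1 = cval b by rewrite /L ifF //; apply/negP; lra.
  rewrite -L0 -L1 -brokenE ?ival_itv // /L.
  by case: ifP.
have [|||r rE] := @path_of_continuous X a b (fun t => mkconfig (h t)).
- apply: config_continuous; apply: (comp_continuous (@broken_continuous _ _ _)).
  exact: ival_continuous.
- apply: cval_inj; rewrite cval_mkconfig /broken ival0.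
  have -> : Num.max 0 (1 - 3 * 0) = 1 :> R by rewrite max_r; lra.
  have -> : Num.max 0 (3 * 0 - 2) = 0 :> R by rewrite max_l //; lra.
  by rewrite scale1r scale0r addr0 addrC subrK.
- apply: cval_inj; rewrite cval_mkconfig /broken ival1.
  have -> : Num.max 0 (1 - 3 * 1) = 0 :> R by rewrite max_l //; lra.
  have -> : Num.max 0 (3 * 1 - 2) = 1 :> R by rewrite max_r; lra.
  by rewrite scale1r scale0r add0r addrC subrK.
by exists r => t; rewrite rE.
Qed.

Lemma broken_time_itv (u t : R) : 0 <= u <= 1 -> 0 <= t <= 1 ->
  0 <= broken_time u t <= 1.
Proof.
move=> /andP[u0 u1] /andP[t0 t1]; rewrite /broken_time.
have m0 : 0 <= Num.max 0 (Num.min 1 (3 * t - 1)) :> R by rewrite le_max lexx.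
have m1 : Num.max 0 (Num.min 1 (3 * t - 1)) <= 1 :> R.
  by rewrite ge_max ler01 ge_min lexx.
by apply/andP; split; nra.
Qed.

Lemma homotopic_broken (a b : X) (L : R -> M) c (p r : {path I from a to b}) :
  continuous L -> L 0 = cval a -> L 1 = cval b -> cone_ok L c ->
  (forall t, near_config (cval (p t)) (L (ival t))) ->
  (forall t, cval (r t) = broken (cval a) c (cval b) (ival t)) ->
  homotopic p r.
Proof.
move=> cL L0 L1 ok pL rE.
have c1 : continuous (fun ts : I * I => ival ts.1).
  by apply: comp_continuous; [exact: ival_continuous | move=> ts; exact: cvg_fst].
have c2 : continuous (fun ts : I * I => ival ts.2).
  by apply: comp_continuous; [exact: ival_continuous | move=> ts; exact: cvg_snd].
have cLi : continuous (fun t : I => L (ival t)).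
  exact: (comp_continuous cL (@ival_continuous R)).
have hL t : config_set (L (ival t)) := near_config_set (pL t).
have [|||l lE] := @path_of_continuous X a b (fun t => mkconfig (hL t)).
- exact: config_continuous.
- by apply: cval_inj; rewrite cval_mkconfig ival0.
- by apply: cval_inj; rewrite cval_mkconfig ival1.
(* First stage: straight segments from [p] to [l], each inside the convex ball centred at [p t]. *)
apply: (@homotopic_trans _ _ _ _ _ l).
  apply: (homotopic_config (H := fun ts =>
    (1 - ival ts.2) *: cval (p ts.1) + ival ts.2 *: L (ival ts.1))).
  - apply: mx_affine_continuous => //; first exact: csub_continuous.
      apply: (comp_continuous (@cval_continuous _ _)).
      apply: (comp_continuous (g := p)); first exact: cts_fun.
      by move=> ts; exact: cvg_fst.
    exact: (comp_continuous cL).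
  - move=> [t s] /=; apply: (@near_config_set _ _ (cval (p t))).
    apply: near_config_conv => //; first exact: ival_itv.
    exact/near_config_refl/cvalP.
  - by move=> t /=; rewrite ival0 subr0 scale1r scale0r addr0.
  - by move=> t /=; rewrite ival1 subrr scale1r scale0r add0r lE.
  - by move=> s /=; rewrite ival0 L0 path_zero -scalerDl subrK scale1r.
  - by move=> s /=; rewrite ival1 L1 path_one -scalerDl subrK scale1r.
have c3 : continuous (fun ts : I * I => 3 * ival ts.1) by exact: mulc_continuous.
have ch : continuous (fun ts : I * I => broken_height (ival ts.2) (ival ts.1)).
  apply: mulf_continuous => //; apply: minf_continuous => //.
  apply: minf_continuous; first by move=> ts; exact: cvg_cst.
  exact: csub_continuous.
have ct : continuous (fun ts : I * I => broken_time (ival ts.2) (ival ts.1)).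
  apply: addf_continuous; apply: mulf_continuous => //; first exact: csub_continuous.
  apply: maxf_continuous; first by move=> ts; exact: cvg_cst.
  apply: minf_continuous; first by move=> ts; exact: cvg_cst.
  exact: subc_continuous.
(* Second stage: [l] is raised along the cone, with its time reparametrised so that the endpoints
   stay fixed. *)
apply: (homotopic_config (H := fun ts =>
    (1 - broken_height (ival ts.2) (ival ts.1)) *:
        L (broken_time (ival ts.2) (ival ts.1))
    + broken_height (ival ts.2) (ival ts.1) *: c)).
- apply: mx_affine_continuous => //; first exact: csub_continuous.
    exact: (comp_continuous cL).
  by move=> ts; exact: cvg_cst.
- by move=> ts; apply: ok; apply: broken_time_itv; exact: ival_itv.
- move=> t /=; rewrite ival0 /broken_height /broken_time !mul0r subr0 scale1r.
  by rewrite scale0r addr0 mul1r addr0 lE.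
- by move=> t /=; rewrite ival1 brokenE ?ival_itv // L0 L1 rE.
- move=> s /=; rewrite ival0 broken_time0 broken_height0.
  by rewrite subr0 scale1r scale0r addr0 L0.
- move=> s /=; rewrite ival1 broken_time1 broken_height1.
  by rewrite subr0 scale1r scale0r addr0 L1.
Qed.

(** The vertices are values of [p] on a grid so fine that [p t] is near both ends of its segment;
    convexity of the balls covers the rest. The list [s] records the finitely many segments for
    [generic_cone]. *)
Lemma exists_pl_near (a b : X) (p : {path I from a to b}) :
  exists (L : R -> M) (s : seq (M * M)),
    [/\ continuous L, L 0 = cval a, L 1 = cval b,
     forall t, near_config (cval (p t)) (L (ival t)) &
     forall t, 0 <= t <= 1 -> exists x y l, (x, y) \in s /\
       L t = (1 - l) *: x + l *: y].
Proof.
pose f t := cval (p (clamp t)).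
have cf : continuous f.
  apply: (comp_continuous (@cval_continuous _ _)).
  apply: (comp_continuous (g := p)); first exact: cts_fun.
  exact: clamp_continuous.
have [N hN] : exists N : nat, forall s t t' : R, 0 <= s <= 1 -> 0 <= t <= 1 ->
    `|t - t'| <= N.+1%:R^-1 -> near_config (f t) (f t').
  (* The first variable is a dummy, later instantiated with [0]. *)
  apply: (@uniform_subdivision R (fun _ t t' => near_config (f t) (f t'))) => s t.
  have [[A C] /= [nA nC] AC] : \forall q \near (t, t),
      near_config (f q.1) (f q.2).
    apply: (near_config_open (f := fun q : R * R => f q.1)
      (g := fun q : R * R => f q.2)).
    - by apply: (comp_continuous cf) => q; exact: cvg_fst.
    - by apply: (comp_continuous cf) => q; exact: cvg_snd.
    - exact/near_config_refl/cvalP.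
  have /nbhs_ballP[r /= r0 br] : nbhs t (A `&` C) by exact: filterI.
  exists r => // s' t' t'' _ h h'.
  apply: (AC (t', t'')); split; [exact: (br t' h).1 | exact: (br t'' h').2].
pose v k := f (k%:R / N.+1%:R).
have D0 : 0 < N.+1%:R :> R by [].
have seg t : 0 <= t <= 1 -> exists k l, [/\ (k < N.+1)%N, 0 <= l <= 1,
    N.+1%:R * t = k%:R + l & pl v N.+1 t = (1 - l) *: v k + l *: v k.+1].
  move=> /andP[t0 t1].
  have [|k [kN hk]] := @unit_subdivision R N (N.+1%:R * t).
    by rewrite mulr_ge0 // -{2}(mulr1 N.+1%:R) ler_pM2l.
  exists k, (N.+1%:R * t - k%:R); have e : N.+1%:R * t = k%:R + (N.+1%:R * t - k%:R) by ring.
  by split => //; apply: pl_segment.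
exists (pl v N.+1), [seq (v k, v k.+1) | k <- iota 0 N.+1]; split.
- exact: pl_continuous.
- rewrite (@pl_segment _ _ _ v N.+1 0 0) //; last by rewrite mulr0 addr0.
    by rewrite subr0 scale1r scale0r addr0 /v /f mul0r path_zero.
  by rewrite lexx ler01.
- rewrite (@pl_segment _ _ _ v N.+1 N 1) //; last by rewrite mulr1 natr1.
    by rewrite subrr scale1r scale0r add0r /v /f divff ?path_one // gt_eqF.
  by rewrite lexx ler01.
- move=> t; have [k [l [kN l01 tE ->]]] := seg _ (ival_itv t).
  rewrite -{1}(ivalK t); case/andP: (l01) => l0 l1.
  apply: near_config_conv => //; apply: (hN 0); rewrite ?lexx ?ler01 ?ival_itv //.
  + have -> : ival t - k%:R / N.+1%:R = l / N.+1%:R.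
      by apply: (mulfI (lt0r_neq0 D0)); rewrite mulrBr tE !mulrA !(mulrC N.+1%:R) !mulfK ?lt0r_neq0 //; ring.
    by rewrite ger0_norm ?divr_ge0 // ler_pdivrMr // mulVf // gt_eqF.
  + have -> : ival t - k.+1%:R / N.+1%:R = - ((1 - l) / N.+1%:R).
      apply: (mulfI (lt0r_neq0 D0)).
      by rewrite mulrBr mulrN tE !mulrA !(mulrC N.+1%:R) !mulfK ?lt0r_neq0 // -natr1; ring.
    rewrite normrN ger0_norm; last by rewrite divr_ge0 // subr_ge0.
    by rewrite ler_pdivrMr // mulVf ?gt_eqF //; lra.
- move=> t /seg[k [l [kN _ _ ->]]]; exists (v k), (v k.+1), l; split => //.
  by apply: map_f; rewrite mem_iota.
Qed.

Lemma config_simply_connected (a b : X) (p p' : {path I from a to b}) :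
  homotopic p p'.
Proof.
have [L [s [cL L0 L1 pL sL]]] := exists_pl_near p.
have [L' [s' [cL' L0' L1' pL' sL']]] := exists_pl_near p'.
(* One apex serves both polygonal paths, so both given paths deform to the same broken path. *)
have [c hc] := generic_cone (s ++ s').
have ok : cone_ok L c.
  move=> t y t01; have := near_config_set (pL (clamp t)); rewrite clampK //.
  have [x [z [l [xz ->]]]] := sL _ t01.
  by apply: hc; rewrite mem_cat xz.
have ok' : cone_ok L' c.
  move=> t y t01; have := near_config_set (pL' (clamp t)); rewrite clampK //.
  have [x [z [l [xz ->]]]] := sL' _ t01.
  by apply: hc; rewrite mem_cat xz orbT.
have [y|y|r rE] := @exists_broken_path a b c.
- by rewrite -L0; apply: ok; rewrite lexx ler01.
- by rewrite -L1; apply: ok; rewrite lexx ler01.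
apply: (@homotopic_trans _ _ _ _ _ r).
  exact: (homotopic_broken cL L0 L1 ok pL rE).
exact/homotopic_sym/(homotopic_broken cL' L0' L1' ok' pL' rE).
Qed.

Lemma config_path_connected (a b : X) : exists p : {path I from a to b}, True.
Proof.
(* Cones over degenerate segments are the lines from the endpoints to the apex. *)
have [c hc] := generic_cone [:: (cval a, cval a); (cval b, cval b)].
have conv (x : M) : (1 - 0) *: x + 0 *: x = x by rewrite subr0 scale1r scale0r addr0.
have [y|y|r _] := @exists_broken_path a b c; last by exists r.
- rewrite -[cval a]conv; apply: hc; rewrite ?inE ?eqxx // conv; exact: cvalP.
- rewrite -[cval b]conv; apply: hc; rewrite ?inE ?eqxx ?orbT // conv.
  exact: cvalP.
Qed.

End SimplyConnected.

(** * Monodromy *)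

Section Monodromy.
Local Open Scope classical_set_scope.
Local Open Scope ring_scope.
Local Open Scope quotient_scope.
Context {R : realType} {n : nat} (G : {group 'S_n}) (y : config_quotient R G).
Local Notation X := (config R n).
Local Notation I := (unit_interval R).
Local Notation q := (@orbit_pi R n G).
Local Notation loop := {path I from y to y}.
Local Notation pi1 := (fundamental_group R y).

Definition monodromy_base : X := repr y.
Local Notation x0 := monodromy_base.

Definition has_monodromy (p : loop) (g : 'S_n) : Prop :=
  exists F : {path I from x0 to config_perm g x0}, forall t, q (F t) = p t.

Lemma config_perm_free (g g' : 'S_n) (x : X) :
  config_perm g x = config_perm g' x -> g = g'.
Proof.
move=> e; apply/eqP; rewrite eq_mulVg1; apply/eqP.
have nx : near_config (cval x) (cval x) by exact/near_config_refl/cvalP.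
apply: (near_config_row_perm_eq1 nx).
by rewrite -cval_config_perm config_permM -e -config_permM mulVg config_perm1.
Qed.

Lemma exists_monodromy (p : loop) : exists2 g, g \in G & has_monodromy p g.
Proof.
(* Path lifting is the case of a homotopy constant in its first variable. *)
have [||F [cF F0 qF]] := @homotopy_lifting R n G (fun st => p st.2) x0.
- by apply: (comp_continuous (g := p)); [exact: cts_fun | move=> ?; exact: cvg_snd].
- by move=> s /=; rewrite path_zero orbit_pi_repr.
have cF1 : continuous (fun t => F (zero, t)).
  apply: (comp_continuous cF).
  apply: pair_continuous; last by move=> t; exact: cvg_id.
  exact: cst_continuous.
have [g gG Fg] : exists2 g, g \in G & F (zero, one) = config_perm g x0.
  by apply/orbit_piP; rewrite qF /= path_one; exact: orbit_pi_repr.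
by exists g => //; exists (mk_path cF1 (F0 zero) Fg) => t; exact: qF.
Qed.

(** By uniqueness, [F] and [F'] are two edges of the lifted homotopy. The edge joining their ends
    lifts a constant path, so it is constant, and freeness of the action gives [g = g']. *)
Lemma homotopic_monodromy (p p' : loop) g g' : homotopic p p' ->
  has_monodromy p g -> has_monodromy p' g' -> g = g'.
Proof.
move=> [H [cH H0 H1 Hx Hy]] [F FE] [F' FE'].
(* The variables are swapped because lifting proceeds along the second one, which must be the time
   of the loops. *)
have [||K [cK K0 qK]] := @homotopy_lifting R n G (fun st => H (st.2, st.1)) x0.
- apply: (comp_continuous cH).
  by apply: pair_continuous => ?; [exact: cvg_snd | exact: cvg_fst].
- by move=> s /=; rewrite Hx orbit_pi_repr.
have cK2 s : continuous (fun t => K (s, t)).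
  apply: (comp_continuous cK).
  apply: pair_continuous; last by move=> t; exact: cvg_id.
  exact: cst_continuous.
have cK1 : continuous (fun s => K (s, one)).
  apply: (comp_continuous cK).
  apply: pair_continuous; first by move=> s; exact: cvg_id.
  exact: cst_continuous.
have KF : (fun t => K (zero, t)) =1 F.
  apply: (@lift_uniq R n G) => //; first exact: cts_fun.
  - by move=> t; rewrite qK FE -H0.
  - by rewrite K0 path_zero.
have KF' : (fun t => K (one, t)) =1 F'.
  apply: (@lift_uniq R n G) => //; first exact: cts_fun.
  - by move=> t; rewrite qK FE' -H1.
  - by rewrite K0 path_zero.
have Kc : (fun s => K (s, one)) =1 (fun=> K (zero, one)).
  apply: (@lift_uniq R n G) => //; first exact: cst_continuous.
  by move=> s; rewrite !qK /= !Hy.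
have := Kc one; rewrite (KF' one) (KF one) !path_one.
by move/config_perm_free.
Qed.

(** The second lift has to start where the first ends, so it is translated by [g]; by [config_permM]
    it then ends at [g * g'], in this order. *)
Lemma monodromy_concat (p p' : loop) g g' : g \in G ->
  has_monodromy p g -> has_monodromy p' g' ->
  has_monodromy (concat p p') (g * g')%g.
Proof.
move=> gG [F FE] [F' FE'].
have [|||F'' F''E] := @path_of_continuous R X (config_perm g x0)
    (config_perm (g * g') x0) (fun t => config_perm g (F' t)).
- apply: (comp_continuous (@config_perm_continuous _ _ g)); exact: cts_fun.
- by rewrite path_zero.
- by rewrite path_one config_permM.
exists (concat F F'') => t.
rewrite /= !concatE; case: ifP => _; first exact: FE.
rewrite F''E -FE'; apply/esym/orbit_piP; exists g => //.
Qed.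

Lemma monodromy_surj g : g \in G -> exists p : loop, has_monodromy p g.
Proof.
move=> gG; have [F _] := @config_path_connected R n x0 (config_perm g x0).
have [|||p pE] := @path_of_continuous R _ y y (fun t => q (F t)).
- apply: (comp_continuous (@orbit_pi_continuous _ _ G)); exact: cts_fun.
- by rewrite path_zero; exact: orbit_pi_repr.
- rewrite path_one -[RHS]orbit_pi_repr; apply/esym/orbit_piP; by exists g.
by exists p, F => t; rewrite pE.
Qed.

(** The lifts share their endpoints, so simple connectivity gives a homotopy upstairs, which
    projects down. *)
Lemma monodromy_inj (p p' : loop) g :
  has_monodromy p g -> has_monodromy p' g -> homotopic p p'.
Proof.
move=> [F FE] [F' FE'].
have [H [cH H0 H1 Hx Hy]] := config_simply_connected F F'.
have qx0 : q x0 = y by exact: orbit_pi_repr.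
exists (fun ts => q (H ts)); split => [|t|t|s|s].
- exact: (comp_continuous (@orbit_pi_continuous _ _ G)).
- by rewrite H0 FE.
- by rewrite H1 FE'.
- by rewrite Hx qx0.
- by rewrite Hy; have := FE one; rewrite !path_one.
Qed.

Lemma exists_monodromy_iso : exists f : pi1 -> [subg G],
  {morph f : a b / (a * b)%g} /\ bijective f.
Proof.
have /choice[m mP] (a : pi1) :
    exists g : [subg G], has_monodromy (repr a) (sgval g).
  by have [g gG hg] := exists_monodromy (repr a); exists (subg G g); rewrite subgK.
(* [m] is defined through [repr], but any loop in the class computes it. *)
have mE (a : pi1) (p : loop) g : \pi_pi1 p = a -> has_monodromy p g -> sgval (m a) = g.
  move=> <- hp; exact: (homotopic_monodromy (pi1_reprK p) (mP _)).
exists m; split.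
  move=> a b; apply: val_inj => /=.
  apply: (mE _ (concat (repr a) (repr b))) => //.
  by apply: monodromy_concat; [exact: subgP | exact: mP | exact: mP].
have /choice[w wP] (g : [subg G]) : exists a, m a = g.
  have [p pg] := monodromy_surj (subgP g).
  by exists (\pi_pi1 p); apply: val_inj; exact: (mE _ p).
(* [m] after [w] is the identity by choice of [w]; in the other order, [w (m a)] and [a] have the
   same monodromy. *)
exists w => // a.
rewrite -[RHS]reprK -[LHS]reprK; apply/pi1_eqP.
apply: (monodromy_inj (g := sgval (m a))) => //.
by rewrite -{2}(wP (m a)).
Qed.

End Monodromy.

Theorem mainTheorem1 (R : realType) (n : nat) (n_ge1 : (1 <= n)%N)
    (G : {group 'S_n}) (y : config_quotient R G) :
  exists f : {multiplicative fundamental_group R y -> [subg G]}, bijective f.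
Proof.
have [f [fM bij_f]] := exists_monodromy_iso y.
pose F : {multiplicative fundamental_group R y -> [subg G]} :=
  HB.pack f (isMultiplicative.Build _ _ f fM).
by exists F.
Qed.
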